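(* For all integers $n\geq 0$ and $m\geq 0$, $$B_{9,5}\left(5^{4m}n+\frac{5^{4m}-1}{2}\right)\equiv 2^m B_{9,5}(n)\pmod 3,$$ and, for each $k\in\{4,5\}$, $$B_{9,5}\left(5^{4m+4}n+\frac{(2k+1)\cdot 5^{4m+3}-1}{2}\right)\equiv 0\pmod 3.$$
   Context: For integers $l,m>1$, an $l$-regular partition is a partition none of whose parts is divisible by $l$. A $(l,m)$-regular bipartition of $n$ is a pair of partitions $(\lambda,\mu)$ such that the sum of all parts of $\lambda$ and $\mu$ is $n$, $\lambda$ is $l$-regular and $\mu$ is $m$-regular. $B_{l,m}(n)$ denotes the number of $(l,m)$-regular bipartitions of $n$; equivalently $\sum_{n\ge 0}B_{l,m}(n)q^n=\frac{f_lf_m}{f_1^2}$, where $f_k=\prod_{j\ge1}(1-q^{jk})$. *)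

(* Defs.v *)
From HB Require Import structures.
From mathcomp Require Import all_boot.

Set Implicit Arguments.
Unset Strict Implicit.
Unset Printing Implicit Defensive.

Definition is_partition (s : seq nat) : bool := sorted geq s && (0 \notin s).

Definition is_regular (l : nat) (s : seq nat) : bool :=
  all (fun x => ~~ (l %| x)) s.

Definition is_regular_bipartition (l m n : nat) (p : seq nat * seq nat) : bool :=
  [&& is_partition p.1, is_partition p.2,
      is_regular l p.1, is_regular m p.2 & sumn p.1 + sumn p.2 == n].

(* A partition of an integer at most n has at most n parts, each at most n, so
   bounded sequences over 'I_n.+1 give a finite type containing all the
   bipartitions of n; see boundedP and bounded_inj. *)
Definition bounded (n : nat) (p : {bseq n of 'I_n.+1} * {bseq n of 'I_n.+1}) :
  seq nat * seq nat := (map val p.1, map val p.2).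

Definition B (l m n : nat) : nat :=
  #|[set p : {bseq n of 'I_n.+1} * {bseq n of 'I_n.+1} |
      is_regular_bipartition l m n (bounded p)]|.

Lemma bounded_inj n : injective (@bounded n).
Proof.
move=> [s t] [s' t'] [/(inj_map val_inj)/val_inj -> ].
by move=> /(inj_map val_inj)/val_inj ->.
Qed.

Lemma bounded_seq n (s : seq nat) : is_partition s -> sumn s <= n ->
  exists b : {bseq n of 'I_n.+1}, map val b = s.
Proof.
move=> /andP[_ s0] sn.
have sz : size s <= sumn s.
  elim: s s0 {sn} => //= x s IH; rewrite inE negb_or eq_sym -lt0n => /andP[x0 /IH].
  by rewrite -add1n; apply: leq_add.
have mem x : x \in s -> x <= sumn s.
  elim: s {s0 sn sz} => //= y s IH; rewrite inE => /orP[/eqP->|/IH h].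
    exact: leq_addr.
  exact: leq_trans h (leq_addl _ _).
have szb : size (map (@inord n) s) <= n by rewrite size_map (leq_trans sz).
exists (Bseq szb); rewrite /= -map_comp -[RHS]map_id.
by apply/eq_in_map => x xs /=; rewrite inordK // ltnS (leq_trans (mem _ xs)).
Qed.

Lemma boundedP l m n (p : seq nat * seq nat) :
  is_regular_bipartition l m n p -> exists b, bounded (n := n) b = p.
Proof.
case: p => s t /and5P[/= ps pt _ _ /eqP st].
have [|b bs] := bounded_seq (n := n) ps; first by rewrite -st leq_addr.
have [|c ct] := bounded_seq (n := n) pt; first by rewrite -st leq_addl.
by exists (b, c); rewrite /bounded /= bs ct.
Qed.

(* Main.v *)
Require Import Defs.
From HB Require Import structures.
From mathcomp Require Import all_boot all_order all_algebra all_field.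
From mathcomp Require Import boolp zify ring.

(**
Write f_k for the product of the 1 - q^(kj). Modulo 3 one has f_1^9 = f_9, so
the generating function of B_{9,5} is F = f_1^7 f_5. Put G = q f_1 f_5^7 and let
U send a series with coefficients a(n) to the series with coefficients
a(5n + 2). Modulo 3, U F = - F - G and U G = - F, whence U^3 F = G and
U^4 F = - F = 2 F; moreover the exponents of G are 1, 2 or 3 mod 5. Both
congruences follow by iteration.

The action of U comes from f_1 = x(q^5) - q f_25 + q^2 z(q^5), which is the
pentagonal number theorem sorted by residues mod 5, and two relations.
First, x z = - f_5^2: the quadratic form (6k - 1)^2 + (6l - 1)^2 has an isometry
(a reflection with denominator 5) that permutes the terms contributing to
x z + f_5^2 and reverses their signs. Second, multiplying the five series
f_1(w^i q), where w is a primitive fifth root of unity, and replacing q^5 by q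
gives (x^5 + q^2 z^5 - 11 q f_5^5) f_5 = f_1^6. The root w lives in an algebraic
closure of the field with three elements, over which all series are taken.
*)

Set Implicit Arguments.
Unset Strict Implicit.
Unset Printing Implicit Defensive.

Import GRing.Theory.

(** * Formal power series *)

Section PowerSeries.
Local Open Scope ring_scope.
Variable K : comNzRingType.

Definition fps := nat -> K.

HB.instance Definition _ := gen_eqMixin fps.
HB.instance Definition _ := gen_choiceMixin fps.

Implicit Types (f g h : fps) (p q : {poly K}).

Lemma fpsP f g : (forall n, f n = g n) -> f = g.
Proof. exact: funext. Qed.

Definition fps_of_poly p : fps := fun n => p`_n.
Definition fps_add f g : fps := fun n => f n + g n.
Definition fps_opp f : fps := fun n => - f n.
Definition fps_mul f g : fps := fun n => \sum_(i < n.+1) f i * g (n - i)%N.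

Fact fps_addA : associative fps_add.
Proof. by move=> f g h; apply: fpsP => n; apply: addrA. Qed.
Fact fps_addC : commutative fps_add.
Proof. by move=> f g; apply: fpsP => n; apply: addrC. Qed.
Fact fps_add0 : left_id (fps_of_poly 0) fps_add.
Proof. by move=> f; apply: fpsP => n; rewrite /fps_add /fps_of_poly coef0 add0r. Qed.
Fact fps_addN : left_inverse (fps_of_poly 0) fps_opp fps_add.
Proof.
by move=> f; apply: fpsP => n; rewrite /fps_add /fps_of_poly coef0 addNr.
Qed.

HB.instance Definition _ :=
  GRing.isZmodule.Build fps fps_addA fps_addC fps_add0 fps_addN.

Definition trunc n f : {poly K} := \poly_(i < n.+1) f i.

Lemma coef_trunc n f i : (i <= n)%N -> (trunc n f)`_i = f i.
Proof. by move=> le_in; rewrite coef_poly ltnS le_in. Qed.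

(** Coefficients up to n of a product depend only on those of the factors up to n, so the ring
    axioms can be read off truncations in [{poly K}]. *)
Lemma fps_mul_coefM n f g p q :
  (forall i, (i <= n)%N -> f i = p`_i) -> (forall i, (i <= n)%N -> g i = q`_i) ->
  forall i, (i <= n)%N -> fps_mul f g i = (p * q)`_i.
Proof.
move=> fp gq i le_in; rewrite coefM; apply: eq_bigr => j _.
have le_ji : (j <= i)%N by rewrite -ltnS.
by rewrite fp ?gq // ?(leq_trans _ le_in) ?leq_subr.
Qed.

Let truncE n f i (le_in : (i <= n)%N) : f i = (trunc n f)`_i.
Proof. by rewrite coef_trunc. Qed.

Fact fps_mulC : commutative fps_mul.
Proof.
move=> f g; apply: fpsP => n; have tr := @truncE n.
by rewrite (fps_mul_coefM (tr f) (tr g)) // (fps_mul_coefM (tr g) (tr f)) // mulrC.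
Qed.

Fact fps_mulA : associative fps_mul.
Proof.
move=> f g h; apply: fpsP => n; have tr := @truncE n.
rewrite (fps_mul_coefM (tr f) (fps_mul_coefM (tr g) (tr h))) //.
by rewrite (fps_mul_coefM (fps_mul_coefM (tr f) (tr g)) (tr h)) // mulrA.
Qed.

Fact fps_mul1 : left_id (fps_of_poly 1) fps_mul.
Proof.
move=> f; apply: fpsP => n; have tr := @truncE n.
by rewrite (fps_mul_coefM (p := 1) _ (tr f)) // mul1r coef_trunc.
Qed.

Fact fps_mulDl : left_distributive fps_mul fps_add.
Proof.
move=> f g h; apply: fpsP => n.
by rewrite /fps_add /fps_mul -big_split; apply: eq_bigr => i _; rewrite mulrDl.
Qed.

Fact fps_one_neq0 : fps_of_poly 1 != fps_of_poly 0.
Proof.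
apply/eqP => /(congr1 (fun f : fps => f 0%N)) /eqP.
by rewrite /fps_of_poly coef1 coef0 oner_eq0.
Qed.

HB.instance Definition _ := GRing.Zmodule_isComNzRing.Build fps
  fps_mulA fps_mulC fps_mul1 fps_mulDl fps_one_neq0.

Lemma fpsD f g n : (f + g) n = f n + g n. Proof. by []. Qed.
Lemma fpsN f n : (- f) n = - f n. Proof. by []. Qed.
Lemma fps0 n : (0 : fps) n = 0. Proof. exact: coef0. Qed.
Lemma fps1 n : (1 : fps) n = (n == 0%N)%:R. Proof. exact: coef1. Qed.
Lemma fpsM f g n : (f * g) n = \sum_(i < n.+1) f i * g (n - i)%N.
Proof. by []. Qed.

Lemma fps_sum (I : Type) (r : seq I) (P : pred I) (F : I -> fps) n :
  (\sum_(i <- r | P i) F i) n = \sum_(i <- r | P i) F i n.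
Proof.
exact: (big_morph (fun f : fps => f n) (fun f g => fpsD f g n) (fps0 n)).
Qed.

Fact fps_of_poly_is_zmod_morphism : zmod_morphism fps_of_poly.
Proof. by move=> p q; apply: fpsP => n; rewrite /fps_of_poly coefB. Qed.
Fact fps_of_poly_is_monoid_morphism : monoid_morphism fps_of_poly.
Proof. by split=> // p q; apply: fpsP => n; rewrite /fps_of_poly coefM. Qed.

HB.instance Definition _ := GRing.isZmodMorphism.Build {poly K} fps
  fps_of_poly fps_of_poly_is_zmod_morphism.
HB.instance Definition _ := GRing.isMonoidMorphism.Build {poly K} fps
  fps_of_poly fps_of_poly_is_monoid_morphism.

Lemma fps_polyE p n : fps_of_poly p n = p`_n. Proof. by []. Qed.

Definition fpsX : fps := fps_of_poly 'X.
Definition fpsC (c : K) : fps := fps_of_poly c%:P.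

Lemma fpsXnM f k n :
  (fpsX ^+ k * f) n = if (n < k)%N then 0 else f (n - k)%N.
Proof.
have tr := @truncE n; rewrite -rmorphXn.
transitivity (('X^k * trunc n f)`_n); first exact: (fps_mul_coefM _ (tr f)).
by rewrite coefXnM coef_trunc ?leq_subr.
Qed.

Lemma fpsX_inj k f g : fpsX ^+ k * f = fpsX ^+ k * g -> f = g.
Proof.
move=> /(congr1 (fun h : fps => fun n => h (n + k)%N)) fg; apply: fpsP => n.
move/(congr1 (fun h : fps => h n)): fg.
by rewrite !fpsXnM ltnNge leq_addl addnK.
Qed.

(** [K] may have zero divisors, so coefficients are compared by strong induction: coefficient n of
    [f * g] is [g n] plus terms in earlier coefficients of [g]. *)
Lemma fps_mulIf f g h : f 0%N = 1 -> f * g = f * h -> g = h.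
Proof.
move=> f0 fgh; apply: fpsP; apply: ltn_ind => n IH.
have := congr1 (fun k : fps => k n) fgh; rewrite !fpsM !big_ord_recl !subn0 f0 !mul1r.
under eq_bigr => i _ do rewrite IH ?lift0 -?subn1 ?ltn_subrL ?(leq_ltn_trans _ (ltn_ord i)) //.
exact: addIr.
Qed.

(** * Congruences modulo powers of q *)

Definition agree n f g := forall i, (i <= n)%N -> f i = g i.

Lemma agree_trunc n f : agree n f (fps_of_poly (trunc n f)).
Proof. by move=> i le_in; rewrite fps_polyE coef_trunc. Qed.

Lemma agree_sym n f g : agree n f g -> agree n g f.
Proof. by move=> fg i le_in; rewrite fg. Qed.

Lemma agree_trans n g f h : agree n f g -> agree n g h -> agree n f h.
Proof. by move=> fg gh i le_in; rewrite fg ?gh. Qed.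

Lemma agreeM n f f' g g' :
  agree n f f' -> agree n g g' -> agree n (f * g) (f' * g').
Proof.
move=> ff gg i le_in; rewrite !fpsM; apply: eq_bigr => j _.
have le_ji : (j <= i)%N by rewrite -ltnS.
by rewrite ff ?gg // ?(leq_trans _ le_in) ?leq_subr.
Qed.

Lemma agreeX n f g k : agree n f g -> agree n (f ^+ k) (g ^+ k).
Proof.
by move=> fg; elim: k => [//|k IH]; rewrite !exprS; apply: agreeM.
Qed.

Lemma agreeP f g : (forall n, agree n f g) -> f = g.
Proof. by move=> fg; apply: fpsP => n; apply: (fg n). Qed.

(** * The substitutions q -> q^d and q -> aq *)

Definition dilate d f : fps := fun n => if (d %| n)%N then f (n %/ d)%N else 0.

Lemma agree_dilate d n f p : (0 < d)%N ->
  agree n f (fps_of_poly p) -> agree n (dilate d f) (fps_of_poly (p \Po 'X^d)).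
Proof.
move=> d_gt0 fp i le_in; rewrite /dilate fps_polyE coef_comp_poly_Xn //.
by case: ifP => // _; rewrite fp // (leq_trans (leq_div _ _)).
Qed.

Lemma dilateD d f g : dilate d (f + g) = dilate d f + dilate d g.
Proof.
by apply: fpsP => n; rewrite fpsD /dilate; case: ifP => //; rewrite addr0.
Qed.

Lemma dilateN d f : dilate d (- f) = - dilate d f.
Proof. by apply: fpsP => n; rewrite fpsN /dilate; case: ifP; rewrite ?oppr0. Qed.

Lemma dilateM d f g : (0 < d)%N -> dilate d (f * g) = dilate d f * dilate d g.
Proof.
move=> d_gt0; apply: agreeP => n.
have fgt : agree n (f * g) (fps_of_poly (trunc n f * trunc n g)).
  by rewrite rmorphM; apply: agreeM; apply: agree_trunc.
apply: agree_trans (agree_dilate d_gt0 fgt) _; rewrite comp_polyM rmorphM.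
by apply: agree_sym; apply: agreeM; apply: agree_dilate => //; apply: agree_trunc.
Qed.

Lemma dilate_poly d p : (0 < d)%N ->
  dilate d (fps_of_poly p) = fps_of_poly (p \Po 'X^d).
Proof. by move=> d_gt0; apply: agreeP => n; apply: agree_dilate. Qed.

Lemma dilate1 d : (0 < d)%N -> dilate d 1 = 1.
Proof. by move=> d_gt0; rewrite dilate_poly // comp_polyC. Qed.

Lemma dilateX d f k : (0 < d)%N -> dilate d (f ^+ k) = dilate d f ^+ k.
Proof.
move=> d_gt0; elim: k => [|k IH]; first by rewrite !expr0 dilate1.
by rewrite !exprS dilateM // IH.
Qed.

Lemma dilate_fpsX d : (0 < d)%N -> dilate d fpsX = fpsX ^+ d.
Proof. by move=> d_gt0; rewrite dilate_poly // comp_polyX rmorphXn. Qed.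

Lemma dilate_inj d : (0 < d)%N -> injective (dilate d).
Proof.
move=> d_gt0 f g fg; apply: fpsP => n.
by have := congr1 (fun h : fps => h (n * d)%N) fg; rewrite /dilate dvdn_mull // mulnK.
Qed.

Definition twist a f : fps := fun n => a ^+ n * f n.

Lemma agree_twist a n f g : agree n f g -> agree n (twist a f) (twist a g).
Proof. by move=> fg i le_in; rewrite /twist fg. Qed.

Lemma twistD a f g : twist a (f + g) = twist a f + twist a g.
Proof. by apply: fpsP => n; rewrite fpsD /twist mulrDr. Qed.

Lemma twistN a f : twist a (- f) = - twist a f.
Proof. by apply: fpsP => n; rewrite fpsN /twist mulrN. Qed.

Lemma twistM a f g : twist a (f * g) = twist a f * twist a g.
Proof.
apply: fpsP => n; rewrite /twist !fpsM mulr_sumr; apply: eq_bigr => i _.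
have le_in : (i <= n)%N by rewrite -ltnS.
by rewrite mulrACA -exprD subnKC.
Qed.

Lemma twist1 a : twist a 1 = 1.
Proof.
apply: fpsP => n; rewrite /twist fps1; case: n => [|n]; first by rewrite mul1r.
by rewrite mulr0.
Qed.

Lemma twistX a f k : twist a (f ^+ k) = twist a f ^+ k.
Proof. by elim: k => [|k IH]; rewrite ?expr0 ?twist1 // !exprS twistM IH. Qed.

Lemma twist_fpsX a : twist a fpsX = fpsC a * fpsX.
Proof.
apply: fpsP => n; rewrite /twist /fpsX /fpsC -rmorphM /= !fps_polyE coefCM coefX.
by case: eqP => [->|_]; rewrite ?mulr0.
Qed.

Lemma twist_dilate a d f : a ^+ d = 1 -> twist a (dilate d f) = dilate d f.
Proof.
move=> ad; apply: fpsP => n; rewrite /twist /dilate.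
case: ifP => [/dvdnP[k ->]|_]; last by rewrite mulr0.
by rewrite mulnC exprM ad expr1n mul1r.
Qed.

(** Extracts one residue class modulo 5: the summand s is supported on exponents congruent to s, so
    only s = r contributes. *)
Lemma dissection (g : nat -> fps) n r : (r < 5)%N ->
  (\sum_(s < 5) fpsX ^+ s * dilate 5 (g s)) (5 * n + r)%N = g r n.
Proof.
move=> lt_r5; rewrite fps_sum (bigD1 (Ordinal lt_r5)) //= big1 ?addr0.
  rewrite fpsXnM ltnNge leq_addl addnK /dilate /=.
  by rewrite dvdn_mulr // mulKn.
move=> s /eqP sr; rewrite fpsXnM /dilate; do 2 case: ifP => //.
move=> d lt; case: sr; apply/val_inj => /=; move: d lt (ltn_ord s) lt_r5; lia.
Qed.

End PowerSeries.
Arguments fpsX {K}.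
Arguments twist {K}.
Arguments dilate {K}.

(** * The products f_d *)

Section EulerProduct.
Local Open Scope ring_scope.
Variable K : comNzRingType.

Definition eprod d N : {poly K} := \prod_(1 <= j < N.+1) (1 - 'X^(d * j)).

(** For d > 0 the factors with j > n cannot reach coefficient n, so each coefficient of the infinite
    product is read off a finite one. *)
Definition feta d : fps K := fun n => (eprod d n)`_n.

Lemma eprodS d N : eprod d N.+1 = eprod d N * (1 - 'X^(d * N.+1)).
Proof. by rewrite /eprod big_nat_recr. Qed.

Lemma eprod0 d : eprod d 0 = 1.
Proof. by rewrite /eprod big_geq. Qed.

Lemma coef_eprod d n N : (0 < d)%N -> (n <= N)%N -> (eprod d N)`_n = feta d n.
Proof.
move=> d_gt0; elim: N => [|N IH]; first by rewrite leqn0 => /eqP ->.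
rewrite leq_eqVlt => /predU1P[-> //|]; rewrite ltnS => le_nN.
rewrite eprodS mulrBr mulr1 coefB coefMXn IH // ifT ?subr0 //.
by rewrite (leq_ltn_trans le_nN) // leq_pmull.
Qed.

Lemma agree_feta d n N : (0 < d)%N -> (n <= N)%N ->
  agree n (feta d) (fps_of_poly (eprod d N)).
Proof.
move=> d_gt0 le_nN i le_in; rewrite fps_polyE coef_eprod //.
exact: leq_trans le_nN.
Qed.

Lemma feta_0 d : feta d 0%N = 1.
Proof. by rewrite /feta eprod0 coef1. Qed.

Lemma feta_dilate d e : (0 < d)%N -> (0 < e)%N ->
  feta (d * e) = dilate d (feta e).
Proof.
move=> d_gt0 e_gt0; apply: agreeP => n.
apply: agree_trans (agree_feta _ (leqnn n)) _; first by rewrite muln_gt0 d_gt0.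
apply: agree_sym.
apply: agree_trans (agree_dilate d_gt0 (agree_feta e_gt0 (leqnn n))) _.
rewrite /eprod rmorph_prod /= => i _; congr (fps_of_poly _ _).
apply: eq_bigr => j _; rewrite rmorphB rmorph1 /= rmorphXn /= comp_polyX.
by rewrite -exprM mulnA.
Qed.

Lemma fps_polyXn k : fps_of_poly ('X^k : {poly K}) = fpsX ^+ k.
Proof. exact: rmorphXn. Qed.

Lemma fps_eprodS d N :
  fps_of_poly (eprod d N.+1)
  = fps_of_poly (eprod d N) * (1 - (fpsX : fps K) ^+ (d * N.+1)).
Proof. by rewrite eprodS rmorphM rmorphB rmorph1 /= fps_polyXn. Qed.

Lemma fps_char3 : (3%:R = 0 :> K) -> (3%:R = 0 :> fps K).
Proof.
by move=> K3; rewrite -(rmorph_nat (@fps_of_poly K)) -polyC_natr K3 polyC0 rmorph0.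
Qed.

Lemma fps_eprod_Frobenius N : (3%:R = 0 :> K) ->
  fps_of_poly (eprod 9 N) = fps_of_poly (eprod 1 N) ^+ 9.
Proof.
move=> char3; have fps3 := fps_char3 char3.
elim: N => [|N IH]; first by rewrite !eprod0 rmorph1 expr1n.
rewrite !fps_eprodS IH exprMn mul1n mulnC exprM; congr (_ * _).
move: (fpsX ^+ _) => t.
(* The cofactor of 3 lists the middle signed binomial coefficients of the ninth power, divided by
   3. *)
have -> : (1 - t) ^+ 9 = 1 - t ^+ 9 + 3%:R * (- 3%:R * t + 12%:R * t ^+ 2 -
    28%:R * t ^+ 3 + 42%:R * t ^+ 4 - 42%:R * t ^+ 5 + 28%:R * t ^+ 6
    - 12%:R * t ^+ 7 + 3%:R * t ^+ 8) by ring.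
by rewrite fps3 mul0r addr0.
Qed.

Lemma feta9 : (3%:R = 0 :> K) -> feta 9 = feta 1 ^+ 9.
Proof.
move=> char3; apply: agreeP => n.
apply: agree_trans (agree_feta _ (leqnn n)) _ => //.
rewrite fps_eprod_Frobenius //; apply/agreeX/agree_sym.
exact: agree_feta.
Qed.

(* The norm from K[[q]] to K[[q^5]] when w is a primitive fifth root of 1. *)
Definition norm5 (w : K) (f : fps K) : fps K :=
  f * twist w f * twist (w ^+ 2) f * twist (w ^+ 3) f * twist (w ^+ 4) f.

Lemma norm5M w f g : norm5 w (f * g) = norm5 w f * norm5 w g.
Proof. by rewrite /norm5 !twistM; ring. Qed.

Lemma agree_norm5 w n f g : agree n f g -> agree n (norm5 w f) (norm5 w g).
Proof. by move=> fg; do !apply: agreeM => //; apply: agree_twist. Qed.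

Lemma prod_cyclotomic5 (R : comNzRingType) (u y : R) :
  u ^+ 4 = - 1 - u - u ^+ 2 - u ^+ 3 ->
  (1 - y) * (1 - u * y) * (1 - u ^+ 2 * y) * (1 - u ^+ 3 * y) * (1 - u ^+ 4 * y)
  = 1 - y ^+ 5.
Proof. by move=> uE; ring: uE. Qed.

Variable w : K.
Hypothesis wE : w ^+ 4 = - 1 - w - w ^+ 2 - w ^+ 3.

Lemma root5_1 : w ^+ 5 = 1.
Proof. by ring: wE. Qed.

Lemma fpsCX (a : K) k : fpsC (a ^+ k) = fpsC a ^+ k.
Proof. by rewrite /fpsC polyC_exp rmorphXn. Qed.

Lemma fpsC_root5 : (fpsC w) ^+ 4 = - 1 - fpsC w - fpsC w ^+ 2 - fpsC w ^+ 3.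
Proof.
rewrite -!fpsCX wE /fpsC !polyCB polyCN polyC1.
by rewrite !rmorphB rmorphN rmorph1.
Qed.

Lemma twist_1BXn (a : K) j :
  twist a (1 - fpsX ^+ j) = 1 - (fpsC a : fps K) ^+ j * fpsX ^+ j.
Proof. by rewrite twistD twistN twist1 twistX twist_fpsX exprMn. Qed.

(** If 5 divides j, all five twists fix the factor. Otherwise w^j satisfies the same quartic as w,
    and [prod_cyclotomic5] applies with y = q^j. *)
Lemma norm5_1BXn j : norm5 w (1 - fpsX ^+ j) =
  if (5 %| j)%N then (1 - fpsX ^+ j) ^+ 5 else 1 - fpsX ^+ (5 * j).
Proof.
have c5 : fpsC w ^+ 5 = 1 by rewrite -fpsCX root5_1 /fpsC polyC1 rmorph1.
rewrite /norm5 !twist_1BXn !fpsCX.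
have cX k : (fpsC w ^+ k) ^+ j = (fpsC w ^+ j) ^+ k by rewrite -!exprM mulnC.
rewrite (cX 2) (cX 3) (cX 4).
case: ifP => [/dvdnP[i ->]|ndiv5].
  have -> : fpsC w ^+ (i * 5) = 1 by rewrite mulnC exprM c5 expr1n.
  by rewrite !expr1n !mul1r; move: (fpsX ^+ _) => t; ring.
rewrite mulnC exprM; apply: prod_cyclotomic5.
have := fpsC_root5; move: (fpsC w) c5 => c c5 cE.
have -> : c ^+ j = c ^+ (j %% 5).
  by rewrite {1}(divn_eq j 5) exprD mulnC exprM c5 expr1n mul1r.
have : (0 < j %% 5 < 5)%N by rewrite lt0n -/(dvdn 5 j) ndiv5 ltn_mod.
by case: (j %% 5)%N => [|[|[|[|[|]]]]] // _; ring: cE.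
Qed.

(** Indices j prime to 5 contribute 1 - q^(5j), and j = 5i contributes (1 - q^(5i))^5; [eprod 25 M]
    supplies the factors 1 - q^(25i) still missing from [eprod 5 (5 * M)]. Each induction step adds
    five indices. *)
Lemma norm5_eprod M :
  norm5 w (fps_of_poly (eprod 1 (5 * M))) * fps_of_poly (eprod 25 M) =
  fps_of_poly (eprod 5 (5 * M)) * fps_of_poly (eprod 5 M) ^+ 5.
Proof.
elim: M => [|M IH]; first by rewrite !eprod0 /norm5 !rmorph1 !twist1; ring.
have -> : (5 * M.+1 = (5 * M).+4.+1)%N by lia.
rewrite !fps_eprodS !norm5M !norm5_1BXn !mul1n.
do 4 (rewrite ifF; last by lia).
rewrite ifT; last by lia.
move: IH; rewrite (_ : 5 * (5 * M).+4.+1 = 25 * M.+1)%N; last lia.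
rewrite (_ : (5 * M).+4.+1 = 5 * M.+1)%N; last lia.
set A := norm5 _ _; set B := fps_of_poly _; set C := fps_of_poly _.
set D := fps_of_poly _ => IH.
move: (fpsX ^+ _) (fpsX ^+ _) (fpsX ^+ _) (fpsX ^+ _) (fpsX ^+ _) (fpsX ^+ _).
move=> x6 x5 x4 x3 x2 x1.
transitivity (A * B * ((1 - x1) * (1 - x2) * (1 - x3) * (1 - x4)
  * (1 - x5) ^+ 5 * (1 - x6))); first by ring.
by rewrite IH; ring.
Qed.

Lemma norm5_feta : norm5 w (feta 1) * feta 25 = feta 5 ^+ 6.
Proof.
apply: agreeP => n; apply: (@agree_trans _ _
  (norm5 w (fps_of_poly (eprod 1 (5 * n))) * fps_of_poly (eprod 25 n))).
  by apply: agreeM; [apply: agree_norm5|]; apply: agree_feta => //; lia.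
rewrite norm5_eprod [feta 5 ^+ 6]exprS; apply: agreeM; [|apply: agreeX]; apply: agree_sym;
  apply: agree_feta => //; lia.
Qed.

End EulerProduct.

(** * The pentagonal number theorem *)

(** The range from -N to N, grown outwards by a pair of opposite indices to match one step of the
    recurrence in [shanks_pentagonal]. *)
Fixpoint ints N : seq int :=
  if N is N'.+1 then Posz N :: (- Posz N)%R :: ints N' else [:: 0%R].

Lemma mem_ints N k : (k \in ints N) = (`|k| <= N)%N.
Proof.
elim: N => [|N IH]; first by rewrite inE; lia.
by rewrite !inE IH; lia.
Qed.

Lemma ints_uniq N : uniq (ints N).
Proof. by elim: N => [|N IH] //; rewrite !cons_uniq IH !inE !mem_ints; lia. Qed.

Definition pent (k : int) : nat := (absz (k * (3 * k - 1))%R)./2.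

Lemma pentE (k : int) : (Posz (pent k) * 2 = k * (3 * k - 1))%R.
Proof.
have k_ge0 : (0 <= k * (3 * k - 1))%R by nia.
have [j kE] : exists j, (k * (3 * k - 1) = 2 * j)%R.
  have [i [->|->]] : exists i, (k = 2 * i \/ k = 2 * i + 1)%R.
    by exists (k %/ 2)%Z; lia.
  - by exists (i * (6 * i - 1))%R; ring.
  - by exists ((2 * i + 1) * (3 * i + 1))%R; ring.
by rewrite /pent; lia.
Qed.

Lemma pent_ge k : (`|k| <= pent k)%N.
Proof. by have := pentE k; nia. Qed.

Section Pentagonal.
Local Open Scope ring_scope.
Variable K : comNzRingType.

Definition esign (k : int) : K := (-1) ^+ `|k|%N.

(* Summands of D. Shanks' finite form of the pentagonal number theorem. The sum
   over s agrees with its term s = 0 modulo q^(N+1), and its increments in N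
   telescope. *)
Definition shanks (N s : nat) : {poly K} :=
  (-1) ^+ s * \prod_(s <= j < N) (1 - 'X^(j.+1)) * 'X^(N * s + 'C(s.+1, 2)).

Lemma shanks_step N s : (s <= N)%N ->
  shanks N.+1 s = shanks N s * 'X^s * (1 - 'X^(N.+1)).
Proof.
move=> le_sN; rewrite /shanks big_nat_recr //= mulSn -addnA exprD.
by ring.
Qed.

Lemma shanks_shift N s : (s < N)%N ->
  shanks N s.+1 * (1 - 'X^(s.+1)) = - (shanks N s * 'X^(s + N.+1)).
Proof.
move=> lt_sN; rewrite /shanks [in RHS]big_ltn // mulnS binS bin1.
rewrite !exprD !exprS.
by ring.
Qed.

(** [shanks_shift] turns the correction left by the terms up to m into
    [shanks N m.+1 * (1 - 'X^(m.+1))], which combines with [shanks_step] for the next term. *)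
Lemma shanks_telescope N m : (m <= N)%N ->
  \sum_(s < m.+1) shanks N.+1 s =
  \sum_(s < m.+1) shanks N s - shanks N m * 'X^(m + N.+1).
Proof.
elim: m => [|m IH] le_mN.
  by rewrite !big_ord1 shanks_step // expr0 add0n; ring.
rewrite big_ord_recr [in RHS]big_ord_recr /= IH ?(ltnW le_mN) // shanks_step //.
have := shanks_shift le_mN; rewrite [X in _ = _ - _ * X]exprD.
move: ('X^(m + _)) ('X^(m.+1)) ('X^(N.+1)) (shanks N m) (shanks N m.+1).
move=> x y z U T E; move: (\sum_(_ < _) _) => S.
rewrite -E.
by ring.
Qed.

Lemma shanks_pentagonal N :
  \sum_(s < N.+1) shanks N s = \sum_(k <- ints N) (esign k)%:P * 'X^(pent k).
Proof.
elim: N => [|N IH].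
  rewrite big_ord1 big_seq1 /shanks big_geq // /esign /pent.
  by rewrite !expr0 !mulr1.
rewrite big_ord_recr /= shanks_telescope // IH !big_cons.
(* The correction at m = N yields the term k = N+1, and the new summand s = N+1 yields k =
   -(N+1). *)
have p1 : pent N.+1 = (N.+1 * N.+1 + 'C(N.+1, 2))%N.
  by have := pentE N.+1; have := bin2 N.+1; nia.
have p2 : pent (- N.+1%:Z) = (N.+1 * N.+1 + 'C(N.+2, 2))%N.
  by have := pentE (- N.+1%:Z); have := bin2 N.+2; nia.
rewrite p1 p2 /esign abszN absz_nat /shanks !big_geq //.
rewrite polyC_exp polyCN polyC1 !mulr1.
have -> : (N.+1 * N.+1 + 'C(N.+1, 2) = (N * N + 'C(N.+1, 2)) + (N + N.+1))%N by lia.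
rewrite [in RHS]exprD [(-1) ^+ N.+1]exprS; ring.
Qed.

End Pentagonal.

(** * Theta series over residue classes of the index modulo 5 *)

Section Theta.
Local Open Scope ring_scope.
Variable K : comNzRingType.

(** By [pent_ge] the range [ints n] contains every index that can contribute to coefficient n. *)
Definition theta (S : pred int) : fps K :=
  fun n => \sum_(k <- ints n | S k && (pent k == n)) esign K k.

Lemma theta_ints S n N : (n <= N)%N ->
  theta S n = \sum_(k <- ints N | S k && (pent k == n)) esign K k.
Proof.
move=> le_nN; rewrite /theta -big_filter -[RHS]big_filter; apply: perm_big.
apply: uniq_perm; rewrite ?filter_uniq ?ints_uniq // => k.
rewrite !mem_filter !mem_ints; have := pent_ge k.
by case: (S k) => //=; case: eqP => //=; lia.
Qed.

Definition theta_poly (S : pred int) N : {poly K} :=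
  \sum_(k <- ints N | S k) (esign K k)%:P * 'X^(pent k).

Lemma agree_theta S n N : (n <= N)%N ->
  agree n (theta S) (fps_of_poly (theta_poly S N)).
Proof.
move=> le_nN i le_in; rewrite fps_polyE (theta_ints _ (leq_trans le_in le_nN)).
rewrite coef_sum big_mkcondr; apply: eq_bigr => k _.
by rewrite coefCM coefXn eq_sym; case: eqP; rewrite ?mulr1 ?mulr0.
Qed.

Lemma feta1_theta : feta K 1 = theta predT.
Proof.
apply: agreeP => n; apply: agree_trans (agree_sym (agree_theta _ (leqnn n))).
move=> i le_in; rewrite fps_polyE /theta_poly -shanks_pentagonal coef_sum.
rewrite big_ord_recl big1 ?addr0 => [|s _].
  rewrite -(@coef_eprod _ 1 _ n) // /shanks expr0 mul1r muln0 bin_small // mulr1.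
  congr (polyseq _)`_i; rewrite /eprod big_add1 /=.
  by apply: eq_bigr => j _; rewrite mul1n.
by rewrite /shanks lift0 coefMXn ifT // mulnS binS bin1; lia.
Qed.

Definition cong5 (r : nat) : pred int := fun k => (k %% 5)%Z == r.

Lemma cong5_cases (k : int) :
  exists2 r, (r < 5)%N & (k %% 5)%Z = r%:Z.
Proof. by exists (absz (k %% 5)%Z); lia. Qed.

(** The grouping follows [pent k] modulo 5: it is 0 for k = 0, 2, it is 1 for k = 1, and it is 2 for
    k = 3, 4 modulo 5. *)
Lemma feta1_dissection : feta K 1 = (theta (cong5 0) + theta (cong5 2))
  + theta (cong5 1) + (theta (cong5 3) + theta (cong5 4)).
Proof.
rewrite feta1_theta; apply: fpsP => n; rewrite !fpsD.
have thetaE S : theta S n =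
  \sum_(k <- ints n) if S k && (pent k == n) then esign K k else 0.
  exact: big_mkcond.
rewrite !thetaE -!big_split; apply: eq_bigr => k _ /=.
rewrite /cong5; have [r] := cong5_cases k.
by case: r => [|[|[|[|[|r]]]]] // _ -> /=; case: ifP; rewrite ?addr0 ?add0r.
Qed.

Lemma theta_supp (S : pred int) n : (forall k, S k -> pent k != n) -> theta S n = 0.
Proof.
move=> Sn; apply: big_pred0 => k.
by have := Sn k; case: (S k) => //= /(_ isT) /negbTE.
Qed.

(** Substituting k = 1 - 5j gives pent k = 1 + 25 pent j and reverses the sign, since k and j have
    opposite parity. *)
Lemma theta_cong5_1 : theta (cong5 1) = - (fpsX * feta K 25).
Proof.
have -> : feta K 25 = dilate 25 (theta predT).
  by rewrite -feta1_theta -feta_dilate.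
apply: fpsP => n; rewrite fpsN -[fpsX]expr1 fpsXnM /dilate.
have [[m ->]|nm] := pselect (exists m, n = (25 * m).+1); last first.
  rewrite theta_supp.
    case: ifP; rewrite ?oppr0 // => n0; case: ifP; rewrite ?oppr0 // => n1.
    by case: nm; exists ((n - 1) %/ 25)%N; lia.
  move=> k; rewrite /cong5 => k1; apply/eqP => kn; case: nm.
  exists (pent ((1 - k) %/ 5)%Z).
  have [j kE] : exists j : int, k = 1 - 5 * j by exists ((1 - k) %/ 5)%Z; lia.
  have -> : ((1 - k) %/ 5)%Z = j by lia.
  by have := pentE k; have := pentE j; rewrite kn kE; nia.
rewrite subn1 /= dvdn_mulr // mulKn // /theta -sumrN.
rewrite -big_filter -[RHS]big_filter.
rewrite [RHS](eq_bigr (fun j => esign K (1 - 5 * j))); last first.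
  move=> j _; rewrite /esign -[- _]mulN1r -exprS -signr_odd -[RHS]signr_odd.
  by congr (_ ^+ nat_of_bool _); lia.
rewrite -(big_map (fun j => 1 - 5 * j) predT (esign K)).
apply: perm_big; apply: uniq_perm.
- by rewrite filter_uniq ?ints_uniq.
- by rewrite map_inj_uniq ?filter_uniq ?ints_uniq // => i j; lia.
move=> k; rewrite mem_filter mem_ints; apply/idP/mapP => [/andP[/andP[k1 kn] _]|[j]].
  have [j kE] : exists j : int, k = 1 - 5 * j.
    by exists ((1 - k) %/ 5)%Z; move: k1; rewrite /cong5; lia.
  exists j => //; rewrite mem_filter mem_ints /=; have := pentE k; have := pentE j.
  by have := pent_ge j; rewrite (eqP kn) kE; nia.
rewrite mem_filter => /andP[/= jm _] ->; rewrite /cong5.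
have := pentE (1 - 5 * j); have := pentE j; have := pent_ge (1 - 5 * j).
by rewrite (eqP jm); nia.
Qed.

Lemma theta_mul (S S' : pred int) n : (theta S * theta S') n =
  \sum_(k <- ints n) \sum_(l <- ints n)
    if [&& S k, S' l & (pent k + pent l == n)%N] then esign K k * esign K l else 0.
Proof.
rewrite (agreeM (agree_theta S (leqnn n)) (agree_theta S' (leqnn n)) (leqnn n)).
rewrite -rmorphM /= fps_polyE /theta_poly big_distrlr /= coef_sum big_mkcond.
apply: eq_bigr => k _; case: (S k) => /=; last by rewrite big1.
rewrite coef_sum big_mkcond; apply: eq_bigr => l _; case: (S' l) => //=.
rewrite mulrACA -exprD -polyCM coefCM coefXn eq_sym.
by case: eqP; rewrite ?mulr1 ?mulr0.
Qed.

End Theta.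

(** * The reflection argument and the 5-dissection of f_1 *)

Section Reflection.
Local Open Scope ring_scope.

(* With a = 6k - 1 and b = 6l - 1 one has 24 (pent k + pent l) + 2 = a^2 + b^2,
   and [reflection] is (a, b) |-> (-(3a + 4b)/5, (3b - 4a)/5), which preserves
   a^2 + b^2; it is integral when b = 3a mod 5, that is l = 3k + 3 mod 5. *)
Definition reflection (p : int * int) : int * int :=
  (((2 - 3 * p.1 - 4 * p.2) %/ 5)%Z, ((1 + 3 * p.2 - 4 * p.1) %/ 5)%Z).

Definition reflectible (n : nat) (p : int * int) : bool :=
  ((p.2 - 3 * p.1 - 3) %% 5 == 0)%Z && (pent p.1 + pent p.2 == n)%N.

Lemma reflectionE n p : reflectible n p ->
  (reflection p).1 * 5 = 2 - 3 * p.1 - 4 * p.2 /\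
  (reflection p).2 * 5 = 1 + 3 * p.2 - 4 * p.1.
Proof. by case: p => k l /andP[/= + _]; rewrite /reflection /=; lia. Qed.

Lemma reflection_reflectible n p : reflectible n p -> reflectible n (reflection p).
Proof.
move=> np; have := reflectionE np; case: (reflection p) => k' l' /= [].
case: p np => k l /andP[/= c5 /eqP pn] kE lE; apply/andP; split => /=; first by lia.
have := pentE k; have := pentE l; have := pentE k'; have := pentE l'.
have {}kE : 5 * k' = 2 - 3 * k - 4 * l by lia.
have {}lE : 5 * l' = 1 + 3 * l - 4 * k by lia.
have : 25 * (k' * (3 * k' - 1) + l' * (3 * l' - 1)) =
       25 * (k * (3 * k - 1) + l * (3 * l - 1)).
  transitivity (5 * k' * (3 * (5 * k') - 5) + 5 * l' * (3 * (5 * l') - 5)).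
    by ring.
  by rewrite kE lE; ring.
by lia.
Qed.

Lemma reflectionK n p : reflectible n p -> reflection (reflection p) = p.
Proof.
move=> np; have := reflectionE np.
have := reflectionE (reflection_reflectible np).
case: (reflection (reflection _)) => k2 l2; case: (reflection _) => k1 l1.
by case: p {np} => k l /= [? ?] [? ?]; congr (_, _); lia.
Qed.

Variable K : comNzRingType.

(** Adding the two equations of [reflectionE] gives 5(k' + l') = 3 - 7k - l, so k' + l' and k + l
    differ in parity. *)
Lemma reflection_sign n p : reflectible n p ->
  esign K (reflection p).1 * esign K (reflection p).2
  = - (esign K p.1 * esign K p.2).
Proof.
move=> np; have := reflectionE np; case: (reflection p) => k' l'.
case: p {np} => k l /= [kE lE].
rewrite /esign -!exprD -[RHS]mulN1r -exprS -[LHS]signr_odd -[RHS]signr_odd.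
by congr (_ ^+ nat_of_bool _); lia.
Qed.

Hypothesis char3 : (3%:R : K) = 0.

Lemma reflectible_sum n (L := [seq p <- [seq (k, l) | k <- ints n, l <- ints n]
    | reflectible n p]) :
  \sum_(p <- L) esign K p.1 * esign K p.2 = 0.
Proof.
(* [pent_ge] bounds both indices by n, so L misses no reflectible pair and the reflection permutes
   L. *)
have memL p : (p \in L) = reflectible n p.
  rewrite mem_filter; case: (boolP (reflectible n p)) => //= /andP[_ /eqP pn].
  case: p pn => k l /= pn; apply/allpairsP; exists (k, l).
  by rewrite !mem_ints /=; have := pent_ge k; have := pent_ge l; split=> //; lia.
have uL : uniq L.
  by apply/filter_uniq/allpairs_uniq; rewrite ?ints_uniq // => -[? ?] [? ?].
set S := \sum_(p <- L) _.
have SN : S = - S.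
  rewrite {1}/S (perm_big (map reflection L)) /=; last first.
    apply: uniq_perm => //.
      rewrite map_inj_in_uniq // => p p'; rewrite !memL => np np' pp'.
      by rewrite -(reflectionK np) pp' (reflectionK np').
    move=> p; rewrite memL; apply/idP/mapP => [np|[p' +  ->]].
      exists (reflection p); rewrite ?memL ?reflection_reflectible //.
      by rewrite (reflectionK np).
    by rewrite memL => /reflection_reflectible.
  rewrite big_map -sumrN big_seq [RHS]big_seq; apply: eq_bigr => p.
  by rewrite memL => /reflection_sign.
(* From S = - S one only gets 2S = 0; characteristic 3 then gives S = 0. *)
have SS : S + S = 0 by rewrite {1}SN addNr.
transitivity (3%:R * S - (S + S)); first by ring.
by rewrite SS char3 mul0r subr0.
Qed.

(** The five products run over the residue pairs (r, s) with s = 3r + 3 modulo 5, that is, over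
    exactly the reflectible pairs. *)
Lemma theta_relation :
  theta K (cong5 0) * theta K (cong5 3) + theta K (cong5 1) * theta K (cong5 1)
  + theta K (cong5 2) * theta K (cong5 4) + theta K (cong5 3) * theta K (cong5 2)
  + theta K (cong5 4) * theta K (cong5 0) = 0.
Proof.
apply: fpsP => n; rewrite !fpsD fps0 !theta_mul -!big_split /=.
rewrite -[RHS](reflectible_sum n) big_filter [RHS]big_mkcond big_allpairs.
apply: eq_bigr => k _; rewrite -!big_split /=; apply: eq_bigr => l _.
rewrite /reflectible /cong5 /=; case: (_ == n); rewrite ?andbF ?addr0 // !andbT.
have [[r r5 kr] [s s5 ls]] := (cong5_cases k, cong5_cases l).
have -> : ((l - 3 * k - 3) %% 5)%Z = ((s%:Z - 3 * r%:Z - 3) %% 5)%Z by lia.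
rewrite kr ls; case: r r5 {kr} => [|[|[|[|[|r]]]]] // _;
  by case: s s5 {ls} => [|[|[|[|[|s]]]]] // _ /=; rewrite ?addr0 ?add0r.
Qed.

(* Ramanujan's dissection: x = f_5 / R and z = - f_5 R, where q^(1/5) R is the
   Rogers-Ramanujan continued fraction. *)
Lemma feta1_5dissection : exists x z : fps K,
  [/\ feta K 1 = dilate 5 x - fpsX * dilate 5 (feta K 5) + fpsX ^+ 2 * dilate 5 z
    & x * z = - feta K 5 ^+ 2].
Proof.
pose X := theta K (cong5 0) + theta K (cong5 2).
pose Z := theta K (cong5 3) + theta K (cong5 4).
(* Modulo 5, the 4 stands for -1 and the final factor 3 is the inverse of 2. *)
have pent5 k r : (k %% 5)%Z = Posz r -> (pent k %% 5 = r * (3 * r + 4) * 3 %% 5)%N.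
  move=> kr; have r5 : (r < 5)%N by lia.
  have := pentE k; rewrite {2 3}(divz_eq k 5) kr; move: (k %/ 5)%Z => j.
  have -> : (j * 5 + r%:Z) * (3 * (j * 5 + r%:Z) - 1) =
     5 * (15 * j * j + 6 * j * r%:Z - j) + r%:Z * (3 * r%:Z - 1) by ring.
  move: (15 * j * j + _ - j) => J; case: r r5 {kr} => [|[|[|[|[|r]]]]] // _;
    by lia.
have EX : X = dilate 5 (fun n => X (5 * n)%N).
  apply: fpsP => n; rewrite /dilate; case: ifP => [d|nd].
    by rewrite mulnC divnK.
  rewrite /X fpsD !theta_supp ?addr0 // => k /eqP /pent5 /= e; apply/eqP => kn;
    move: nd; rewrite -kn; lia.
have EZ : Z = fpsX ^+ 2 * dilate 5 (fun n => Z (5 * n + 2)%N).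
  apply: fpsP => n; rewrite fpsXnM /dilate; case: ifP => [n2|n2].
    rewrite /Z fpsD !theta_supp ?addr0 // => k /eqP /pent5 /= e; apply/eqP => kn;
      move: n2; rewrite -kn; lia.
  case: ifP => [d|nd]; first by rewrite mulnC divnK // subnK //; lia.
  rewrite /Z fpsD !theta_supp ?addr0 // => k /eqP /pent5 /= e; apply/eqP => kn;
    move: nd n2; rewrite -kn; lia.
exists (fun n => X (5 * n)%N), (fun n => Z (5 * n + 2)%N); split.
  rewrite -EX -EZ {1}feta1_dissection theta_cong5_1 (@feta_dilate _ 5 5) //.
apply/(@dilate_inj _ 5) => //; apply/(@fpsX_inj _ 2).
rewrite dilateM // -EX mulrCA -EZ dilateN dilateX // -feta_dilate //.
(* Factored, this relation reads X Z + (q f_25)^2 = 0. *)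
have := theta_relation; rewrite theta_cong5_1 => rel.
apply/eqP; rewrite -subr_eq0 -rel /X /Z; apply/eqP; ring.
Qed.

End Reflection.

(** * The action of U_5 on f_1^7 f_5 and q f_1 f_5^7 *)

(** By homogeneity take x = 1 and write y = a + b, z = ab. The product is (1 - a^5)(1 - b^5), and
    a^5 + b^5 = y^5 - 5 y^3 z + 5 y z^2 becomes 11 y^5 when z = - y^2. *)
Lemma norm_trinomial (R : comNzRingType) (c x y z : R) :
  (c ^+ 4 = - 1 - c - c ^+ 2 - c ^+ 3 -> x * z = - y ^+ 2 ->
  (x - y + z) * (x - c * y + c ^+ 2 * z) * (x - c ^+ 2 * y + c ^+ 4 * z)
  * (x - c ^+ 3 * y + c ^+ 6 * z) * (x - c ^+ 4 * y + c ^+ 8 * z)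
  = x ^+ 5 + z ^+ 5 - 11%:R * y ^+ 5)%R.
Proof. by move=> cE xz; ring: cE xz. Qed.

Lemma trinomial_cube (R : comNzRingType) (a b c : R) : (3%:R = 0 :> R ->
  (a - b + c) ^+ 3 = a ^+ 3 - b ^+ 3 + c ^+ 3)%R.
Proof.
move=> R3; transitivity (a ^+ 3 - b ^+ 3 + c ^+ 3 +
  3%:R * ((a - b) * (c - b) * (a + c)))%R; first by ring.
by rewrite R3 mul0r addr0.
Qed.

Section Recurrences.
Local Open Scope ring_scope.
Variables (K : comNzRingType) (w : K).
Hypotheses (wE : w ^+ 4 = - 1 - w - w ^+ 2 - w ^+ 3) (char3 : 3%:R = 0 :> K).

(** After q -> q^5 both sides are [norm5 w (feta K 1) * feta K 25]: the right by [norm5_feta], the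
    left because twisting the dissected f_1 only multiplies q by powers of w. *)
Lemma dissection_norm (x z : fps K) :
    feta K 1 = dilate 5 x - fpsX * dilate 5 (feta K 5) + fpsX ^+ 2 * dilate 5 z ->
    x * z = - feta K 5 ^+ 2 ->
  (x ^+ 5 + fpsX ^+ 2 * z ^+ 5 - 11%:R * (fpsX * feta K 5 ^+ 5)) * feta K 5
  = feta K 1 ^+ 6.
Proof.
move=> f1E xz; apply/(@dilate_inj _ 5) => //.
rewrite [RHS]dilateX // -(@feta_dilate _ 5 1) // -(norm5_feta wE).
rewrite dilateM // -(@feta_dilate _ 5 5) //; congr (_ * _).
have tw i f : twist (w ^+ i) (dilate 5 f) = dilate 5 f.
  by rewrite twist_dilate // exprAC (root5_1 wE) expr1n.
have tw1 f : twist w (dilate 5 f) = dilate 5 f := tw 1%N f.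
rewrite /norm5 f1E !(twistD, twistN, twistM, twistX) !tw !tw1.
rewrite !(twist_fpsX, fpsCX).
have XZ : dilate 5 x * (fpsX ^+ 2 * dilate 5 z) = - (fpsX * dilate 5 (feta K 5)) ^+ 2.
  by rewrite mulrCA -dilateM // xz dilateN dilateX //; ring.
rewrite -[LHS]/(dilate 5 _).
have := norm_trinomial (fpsC_root5 wE) XZ.
move: (fpsC w) => c E.
transitivity (dilate 5 x ^+ 5 + (fpsX ^+ 2 * dilate 5 z) ^+ 5 -
      11%:R * (fpsX * dilate 5 (feta K 5)) ^+ 5); last by rewrite -E; ring.
have -> : 11%:R * (fpsX * feta K 5 ^+ 5) = (fpsX * feta K 5 ^+ 5) *+ 11.
  by rewrite mulr_natl.
have dilMn f n : dilate 5 (f *+ n) = dilate 5 f *+ n :> fps K.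
  elim: n => [|n IH]; last by rewrite !mulrS dilateD IH.
  by rewrite !mulr0n; apply: fpsP => n; rewrite /dilate !fps0; case: ifP.
rewrite !(dilateD, dilateN, dilMn, dilateX, dilateM) // dilate_fpsX //.
by rewrite mulr_natl; ring.
Qed.

Let fps3 : 3%:R = 0 :> fps K.
Proof. exact: fps_char3. Qed.

(** [form1] and [form2] are the series F and G of the overview. *)
Definition form1 : fps K := feta K 1 ^+ 7 * feta K 5.
Definition form2 : fps K := fpsX * feta K 1 * feta K 5 ^+ 7.

(** The factor f_5^7 is already a series in q^5, so only f_1 is dissected; the extra q shifts its
    residues 0, 1, 2 to 1, 2, 3. *)
Lemma form2_dissection : exists x z : fps K, form2 = \sum_(s < 5) fpsX ^+ s *
  dilate 5 (nth 0 [:: 0; x; - form1; z; 0] s).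
Proof.
have [x [z [f1E _]]] := feta1_5dissection char3.
exists (x * feta K 1 ^+ 7), (z * feta K 1 ^+ 7).
have d0 : dilate 5 (0 : fps K) = 0.
  by apply: fpsP => n; rewrite /dilate !fps0; case: ifP.
rewrite !big_ord_recl big_ord0 /= !d0 dilateN !(dilateX, dilateM) //.
rewrite -(@feta_dilate _ 5 1) // {1}/form2 {1}f1E; ring.
Qed.

Lemma form2_5n n : form2 (5 * n)%N = 0.
Proof.
have [x [z ->]] := form2_dissection.
by rewrite -[(5 * n)%N]addn0 (@dissection _ (nth 0 [:: 0; _; _; _; 0])) //= fps0.
Qed.

Lemma form2_5n4 n : form2 (5 * n + 4)%N = 0.
Proof.
have [x [z ->]] := form2_dissection.
by rewrite (@dissection _ (nth 0 [:: 0; _; _; _; 0])) //= fps0.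
Qed.

Lemma form2_5n2 n : form2 (5 * n + 2)%N = - form1 n.
Proof.
have [x [z ->]] := form2_dissection.
by rewrite (@dissection _ (nth 0 [:: 0; _; _; _; 0])) //= fpsN.
Qed.

Lemma form1_5n2 n : form1 (5 * n + 2)%N = - form1 n - form2 n.
Proof.
have [x [z [f1E xz]]] := feta1_5dissection char3.
have nE := dissection_norm f1E xz.
pose f := feta K 1; pose y := feta K 5.
pose g2 := fpsX ^+ 2 * x * z ^+ 6 - fpsX * (y ^+ 7 + 2%:R * (x ^+ 3 * y * z ^+ 3))
  + x ^+ 6 * z.
have g2E : g2 * f = - form1 - form2.
  have -> : g2 = x * z * (x ^+ 5 + fpsX ^+ 2 * z ^+ 5) - fpsX * y ^+ 7
      - 2%:R * fpsX * y * (x * z) ^+ 3 by rewrite /g2; ring.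
  rewrite xz -/y.
  (* Inserting the term 11 q y^5 exposes the left side of [dissection_norm]; the surplus 9 q f y^7
     vanishes modulo 3. *)
  transitivity (- f * y * ((x ^+ 5 + fpsX ^+ 2 * z ^+ 5 - 11%:R * (fpsX * y ^+ 5)) * y)
     - fpsX * f * y ^+ 7 - 3%:R * (3%:R * (fpsX * f * y ^+ 7))); first by ring.
  by rewrite nE fps3 mul0r subr0 /form1 /form2 -/f -/y; ring.
have dil2 u : dilate 5 (2%:R * u) = 2%:R * dilate 5 u :> fps K.
  by rewrite !mulr_natl !mulr2n dilateD.
(* The components of f_1^7 modulo 3 in residue order, from expanding (f_1^3)^2 f_1 with f_1^3 cubed
   term by term; q^5 is written q. *)
pose g := [:: x ^+ 7 + 2%:R * (fpsX ^+ 2 * y ^+ 4 * z ^+ 3)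
                - 2%:R * (fpsX * x ^+ 3 * y ^+ 3 * z);
   fpsX * (x * y ^+ 6 + 2%:R * (x ^+ 4 * z ^+ 3)) - x ^+ 6 * y
                - 2%:R * (fpsX ^+ 2 * y ^+ 3 * z ^+ 4);
   g2;
   - (2%:R * (x ^+ 4 * y ^+ 3)) - fpsX ^+ 2 * y * z ^+ 6
                + fpsX * (y ^+ 6 * z + 2%:R * (x ^+ 3 * z ^+ 4));
   2%:R * (x ^+ 3 * y ^+ 4) - 2%:R * (fpsX * x * y ^+ 3 * z ^+ 3)
                + fpsX ^+ 2 * z ^+ 7].
have {1}-> : form1 = \sum_(s < 5) fpsX ^+ s * dilate 5 (nth 0 g s * f).
  rewrite /g2 !big_ord_recl big_ord0 /= !(dilateD, dilateN, dilateX, dil2, dilateM) //.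
  rewrite !dilate_fpsX // -(@feta_dilate _ 5 1) // /form1 -/y.
  rewrite (_ : feta K 1 ^+ 7 = (feta K 1 ^+ 3) ^+ 2 * feta K 1); last by ring.
  rewrite f1E trinomial_cube // -/y /bump /=.
  move: (dilate 5 x) (dilate 5 y) (dilate 5 z) (fpsX) => a b c q; ring.
rewrite (@dissection _ (fun s => nth 0 g s * f)) //=.
by rewrite g2E.
Qed.

End Recurrences.

(** * Generating functions of regular partitions *)

Definition regular_parts_le (l k n : nat) (s : seq nat) : bool :=
  [&& is_partition s, is_regular l s, all (geq k) s & sumn s == n].

(* The first argument is fuel; n + k < f suffices. *)
Fixpoint parts (f l k n : nat) : seq (seq nat) :=
  match f, k with
  | 0, _ => [::]
  | _, 0 => if n == 0 then [:: [::]] else [::]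
  | f'.+1, k'.+1 => parts f' l k' n ++
      if (k <= n) && ~~ (l %| k) then [seq k :: s | s <- parts f' l k (n - k)]
      else [::]
  end.

Lemma is_partition_cons x s :
  is_partition (x :: s) = [&& 0 < x, all (geq x) s & is_partition s].
Proof.
rewrite /is_partition /= inE negb_or path_sortedE; last first.
  by move=> a b c ba cb; apply: leq_trans cb ba.
by rewrite lt0n eq_sym; case: (x != 0); case: (all _ _); case: (sorted _ _).
Qed.

(** Either no part equals k+1, or the first part does and may be removed; the bound stays k+1
    because parts may repeat. *)
Lemma regular_parts_leS l k n s : regular_parts_le l k.+1 n s =
  regular_parts_le l k n s || [&& k < n, ~~ (l %| k.+1), head 0 s == k.+1
    & regular_parts_le l k.+1 (n - k.+1) (behead s)].
Proof.
rewrite /regular_parts_le; case: s => [|x s]; first by rewrite /= !andbF orbF.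
rewrite !is_partition_cons /=.
have [->|xk] := eqVneq x k.+1.
  rewrite ltnn /= !andbF /= leqnn /=.
  have -> : (k.+1 + sumn s == n) = (k < n) && (sumn s == n - k.+1) by lia.
  case: (k < n); rewrite ?andbF //=; case: (l %| k.+1); rewrite ?andbF //=.
  by case: (all (geq k.+1) s); rewrite ?andbF.
rewrite !andbF orbF; have -> : (x <= k.+1) = (x <= k) by lia.
have [xk'|] := leqP x k; rewrite ?andbF //.
case: (boolP (all (geq x) s)) => xs; rewrite ?andbF //.
have sub j : x <= j -> all (geq j) s.
  by move=> xj; apply: sub_all xs => y yx; apply: leq_trans yx xj.
by rewrite !sub // leqW.
Qed.

Lemma mem_parts f l k n s : n + k < f ->
  (s \in parts f l k n) = regular_parts_le l k n s.
Proof.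
elim: f k n s => // f IH [|k] n s nkf.
  rewrite /= /regular_parts_le; case: s => [|x s].
    by rewrite (eq_sym 0); case: (n == 0).
  rewrite is_partition_cons /= leqn0; case: x => [|x].
    by case: (n == 0).
  by rewrite /= !andbF; case: (n == 0).
rewrite regular_parts_leS /= mem_cat IH; last by lia.
congr (_ || _); case: ifP => [/andP[kn lk]|]; last first.
  by case: (k < n); case: (l %| k.+1).
rewrite kn lk /=; apply/mapP/andP => [[t + ->]|[]].
  by rewrite IH //=; lia.
case: s => [|x t] //= /eqP -> tP; exists t => //; rewrite IH //; lia.
Qed.

Lemma parts_uniq f l k n : n + k < f -> uniq (parts f l k n).
Proof.
elim: f k n => // f IH [|k] n nkf /=; first by case: ifP.
rewrite cat_uniq IH /=; last by lia.
case: ifP => [/andP[kn lk]|] //=; rewrite map_inj_uniq => [|? ? []//].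
rewrite IH ?andbT; last by lia.
apply/hasPn => s /mapP[t _ ->]; rewrite mem_parts /regular_parts_le; last by lia.
by rewrite /= ltnn !andbF.
Qed.

Definition nparts (l k n : nat) : nat := size (parts (n + k).+1 l k n).

(** Both lists are duplicate-free with the same members; this absorbs changes of fuel as well as of
    the bound on parts. *)
Lemma eq_size_parts l f k n f' k' : n + k < f -> n + k' < f' ->
  regular_parts_le l k n =1 regular_parts_le l k' n ->
  size (parts f l k n) = size (parts f' l k' n).
Proof.
move=> nkf nkf' kk'; apply/perm_size/uniq_perm; rewrite ?parts_uniq // => s.
by rewrite !mem_parts.
Qed.

Lemma npartsS l k n : nparts l k.+1 n =
  nparts l k n + (if (k < n) && ~~ (l %| k.+1) then nparts l k.+1 (n - k.+1) else 0).
Proof.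
rewrite /nparts [in LHS]/= size_cat; congr (_ + _).
  by apply: eq_size_parts => //; lia.
case: ifP => // /andP[kn _]; rewrite size_map.
by apply: eq_size_parts => //; lia.
Qed.

Lemma leq_sumn (s : seq nat) x : x \in s -> x <= sumn s.
Proof.
elim: s => //= y s IH; rewrite inE => /predU1P[->|/IH xs]; first exact: leq_addr.
exact: leq_trans xs (leq_addl _ _).
Qed.

Lemma regular_parts_le_full l k n s : n <= k ->
  regular_parts_le l k n s = [&& is_partition s, is_regular l s & sumn s == n].
Proof.
rewrite /regular_parts_le; case: eqP => [<-|]; rewrite ?andbF // => sk.
have -> : all (geq k) s by apply/allP => x /leq_sumn /= /leq_trans; apply.
by [].
Qed.

Lemma nparts_max l k n : n <= k -> nparts l k n = nparts l n n.
Proof.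
by move=> nk; apply: eq_size_parts => // s; rewrite !regular_parts_le_full.
Qed.

(** Bipartitions are grouped by the sum i of the first component; each fibre matches a product of
    two [parts] lists. *)
Lemma B_nparts l m n :
  B l m n = \sum_(i < n.+1) nparts l i i * nparts m (n - i) (n - i).
Proof.
rewrite /B; set A := [set p | _].
have sumA p : p \in A -> sumn (bounded p).1 + sumn (bounded p).2 = n.
  by rewrite inE => /and5P[_ _ _ _ /eqP].
rewrite -sum1_card.
rewrite (partition_big (fun p => inord (sumn (bounded p).1) : 'I_n.+1) predT) //.
apply: eq_bigr => i _; rewrite sum1_card.
rewrite -(size_allpairs pair) cardE -(size_map (@bounded n)).
apply/perm_size/uniq_perm.
- by rewrite map_inj_uniq ?enum_uniq //; apply: bounded_inj.
- by apply: allpairs_uniq; rewrite ?parts_uniq // => -[? ?] [? ?].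
have le_in : i <= n by rewrite -ltnS.
move=> [s t]; apply/mapP/allpairsP => [[p]|[[s' t'] [+ + ->]]].
  rewrite mem_enum => /andP[pA /eqP pi] st; exists (s, t).
  rewrite !mem_parts // !regular_parts_le_full //.
  have := sumA _ pA; move: pA pi; rewrite inE -st /= => /and5P[/= ps pt rs rt _] pi sn.
  have {}pi : sumn s = i by rewrite -pi inordK // ltnS -sn leq_addr.
  by rewrite ps pt rs rt pi eqxx; split=> //; lia.
rewrite !mem_parts // !regular_parts_le_full //.
move=> /and3P[ps rs /eqP si] /and3P[pt rt /eqP tn].
have st : is_regular_bipartition l m n (s', t').
  by rewrite /is_regular_bipartition ps pt rs rt si tn subnKC /=.
have [p pst] := boundedP st; exists p => //; rewrite mem_enum; apply/andP.
split; first by rewrite inE pst.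
by apply/eqP/val_inj; rewrite pst /= inordK si.
Qed.

(** * Generating series as quotients of the products f_d *)

Section RegularSeries.
Local Open Scope ring_scope.
Variable K : comNzRingType.

Definition fparts (l k : nat) : fps K := fun n => (nparts l k n)%:R.
Definition fregular (l : nat) : fps K := fun n => (nparts l n n)%:R.

(** [npartsS] says that multiplying by 1 - q^(k+1) lowers the bound from k+1 to k when l does not
    divide k+1. *)
Lemma fpartsM l k :
  fparts l k * fps_of_poly (\prod_(1 <= j < k.+1 | ~~ (l %| j)%N) (1 - 'X^j)) = 1.
Proof.
elim: k => [|k IH].
  rewrite big_geq // rmorph1 mulr1; apply: fpsP => n; rewrite fps1 /fparts /nparts /=.
  by case: (n == 0%N).
rewrite big_mkcond big_nat_recr //= -big_mkcond rmorphM mulrCA mulrC.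
rewrite -[RHS]IH; congr (_ * _); apply: fpsP => n.
case: ifP => lk; last first.
  by rewrite rmorph1 mulr1 /fparts npartsS lk andbF addn0.
rewrite rmorphB rmorph1 /= fps_polyXn mulrBr mulr1 fpsD fpsN mulrC fpsXnM.
rewrite /fparts npartsS lk andbT natrD ltnS.
by case: leqP => _; rewrite ?subr0 ?addr0 ?addrK.
Qed.

Lemma prod_multiples l N : (0 < l)%N ->
  \prod_(1 <= j < N.+1 | (l %| j)%N) (1 - 'X^j) = eprod K l (N %/ l).
Proof.
move=> l_gt0; elim: N => [|N IH]; first by rewrite big_geq // div0n eprod0.
rewrite big_mkcond big_nat_recr //= -big_mkcond IH divnS //.
case: ifP => [lN|_]; last by rewrite mulr1.
rewrite add1n eprodS; congr (_ * (1 - 'X^_)).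
by rewrite -[in LHS](divnK lN) divnS // lN mulnC.
Qed.

Lemma fregularM l : (0 < l)%N -> fregular l * feta K 1 = feta K l.
Proof.
move=> l_gt0; apply: agreeP => n.
(* Cutting at l n makes the multiples of l contribute exactly [eprod K l n]. *)
have rC : agree n (fregular l) (fparts l (l * n)).
  move=> i le_in; rewrite /fregular /fparts nparts_max //.
  by rewrite (leq_trans le_in) // leq_pmull.
have le_nln : (n <= l * n)%N by rewrite leq_pmull.
apply: agree_trans (agreeM rC (agree_feta K (leqnn 1) le_nln)) _.
rewrite /eprod; under eq_bigr => j _ do rewrite mul1n.
rewrite (bigID (fun j => ~~ (l %| j)%N)) /= rmorphM mulrA fpartsM mul1r.
under eq_bigl => j do rewrite negbK.
by rewrite prod_multiples // mulKn //; apply/agree_sym/agree_feta.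
Qed.

Lemma B_series l m n : (B l m n)%:R = (fregular l * fregular m) n :> K.
Proof.
by rewrite B_nparts natr_sum fpsM; apply: eq_bigr => i _; rewrite natrM.
Qed.

Lemma B95_form1 n : (3%:R = 0 :> K) -> (B 9 5 n)%:R = form1 K n.
Proof.
move=> char3; rewrite B_series; congr (_ n).
apply: (@fps_mulIf _ (feta K 1 ^+ 2)).
  by rewrite expr2 fpsM big_ord1 !feta_0 mulr1.
transitivity ((fregular 9 * feta K 1) * (fregular 5 * feta K 1)); first by ring.
by rewrite !fregularM // feta9 // /form1; ring.
Qed.

End RegularSeries.

(** * Iterating U_5 *)

Section Iteration.
Local Open Scope ring_scope.
Variables (K : comNzRingType) (w : K).
Hypotheses (wE : w ^+ 4 = - 1 - w - w ^+ 2 - w ^+ 3) (char3 : 3%:R = 0 :> K).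

Lemma form1_125n n : form1 K (125 * n + 62)%N = form2 K n.
Proof.
have -> : (125 * n + 62 = 5 * (5 * (5 * n + 2) + 2) + 2)%N by lia.
rewrite !(form1_5n2 wE, form2_5n2) //.
(* Three steps give -3F - 2G, which is G modulo 3. *)
transitivity (form2 K n - 3%:R * (form1 K n + form2 K n)); first by ring.
by rewrite char3 mul0r subr0.
Qed.

Lemma form1_iter m n :
  form1 K (5 ^ (4 * m) * n + (5 ^ (4 * m) - 1) %/ 2)%N = (2 ^ m)%:R * form1 K n.
Proof.
elim: m => [|m IH]; first by rewrite muln0 expn0 mul1n addn0 mul1r.
have P_odd : odd (5 ^ (4 * m)) by rewrite oddX orbT.
rewrite mulnS expnD; move: (5 ^ (4 * m))%N P_odd IH => P P_odd IH.
(* With N the index for m, the index for m+1 is 125(5N + 2) + 62: three steps lead from F to G, a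
   fourth from G to -F. *)
have -> : (5 ^ 4 * P * n + (5 ^ 4 * P - 1) %/ 2 =
           125 * (5 * (P * n + (P - 1) %/ 2) + 2) + 62)%N.
  by rewrite -mulnA (_ : 5 ^ 4 = 625)%N //; move: (P * n)%N; lia.
rewrite form1_125n form2_5n2 // IH expnS natrM -mulrA.
move: (_ * form1 K n) => u.
transitivity (2%:R * u - 3%:R * u); first by ring.
by rewrite char3 mul0r subr0.
Qed.

Lemma form1_vanish m n k : k = 4%N \/ k = 5%N ->
  form1 K (5 ^ (4 * m + 4) * n + ((2 * k + 1) * 5 ^ (4 * m + 3) - 1) %/ 2)%N = 0.
Proof.
move=> kE; have P_odd : odd (5 ^ (4 * m)) by rewrite oddX orbT.
(* After 4m + 3 steps what remains is a multiple of coefficient 5n + k of G, which is zero in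
   residues 4 and 0 modulo 5. *)
have -> : (5 ^ (4 * m + 4) * n + ((2 * k + 1) * 5 ^ (4 * m + 3) - 1) %/ 2 =
  5 ^ (4 * m) * (125 * (5 * n + k) + 62) + (5 ^ (4 * m) - 1) %/ 2)%N.
  rewrite !(expnD _ (4 * m)); move: (5 ^ (4 * m))%N P_odd => P P_odd.
  rewrite (_ : 5 ^ 4 = 625)%N // (_ : 5 ^ 3 = 125)%N //.
  have -> : (P * 625 * n = 625 * (P * n))%N by rewrite mulnAC mulnC.
  have -> : (P * (125 * (5 * n + k) + 62) = 625 * (P * n) + 125 * (P * k) + 62 * P)%N.
    by lia.
  by case: kE => ->; move: (P * n)%N; lia.
rewrite form1_iter form1_125n; case: kE => ->.
  by rewrite form2_5n4 // mulr0.
by rewrite (_ : 5 * n + 5 = 5 * n.+1)%N ?form2_5n ?mulr0 //; lia.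
Qed.

End Iteration.

(** * Choice of the coefficient ring and return to natural numbers *)

Lemma char3_root5 : exists (K : comNzRingType) (w : K),
  (w ^+ 4 = - 1 - w - w ^+ 2 - w ^+ 3)%R /\ (3%:R = 0 :> K)%R.
Proof.
have [K [iota _]] := countable_algebraic_closure 'F_3.
(* The monic quartic with all lower coefficients moved to the right as -1 is the fifth cyclotomic
   polynomial. *)
have [w wE] := @solve_monicpoly K 4 (fun=> - 1)%R isT.
exists K, w; split; first by rewrite wE !big_ord_recl big_ord0 /=; ring.
by rewrite -(rmorph_nat iota) (_ : 3%:R = 0)%R ?rmorph0 //; apply/val_inj.
Qed.

Lemma eq_natr_mod3 (K : comNzRingType) a b :
  (3%:R = 0 :> K)%R -> (a%:R = b%:R :> K)%R -> a = b %[mod 3].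
Proof.
move=> char3; wlog le_ab : a b / a <= b => [H ab|].
  by case/orP: (leq_total a b) => ?; [|symmetry]; apply: H.
move=> ab; apply/eqP; rewrite eq_sym eqn_mod_dvd //.
have pchar3 : (3 \in [pchar K])%R by rewrite inE char3 eqxx.
by rewrite (dvdn_pcharf pchar3) natrB // ab subrr.
Qed.

Theorem theorem1p2 :
  (forall n m : nat,
     B 9 5 (5 ^ (4 * m) * n + (5 ^ (4 * m) - 1) %/ 2)
       = 2 ^ m * B 9 5 n %[mod 3]) /\
  (forall n m k : nat, (k = 4 \/ k = 5) ->
     B 9 5 (5 ^ (4 * m + 4) * n + ((2 * k + 1) * 5 ^ (4 * m + 3) - 1) %/ 2)
       = 0 %[mod 3]).
Proof.
have [K [w [wE char3]]] := char3_root5.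
split=> [n m | n m k kE]; apply: (eq_natr_mod3 char3).
  by rewrite natrM !B95_form1 // (form1_iter wE).
by rewrite B95_form1 // (form1_vanish wE).
Qed.
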